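(* Let $\alpha\in[0,1]$, let $F_s\ne F_b$ be discrete CDFs on $\mathbb{R}$, let $F=\alpha F_s+(1-\alpha)F_b$, and let $\alpha_0:=\inf\{\gamma\in(0,1]: [F-(1-\gamma)F_b]/\gamma \text{ is a CDF}\}$. If $d(F_b)\not\subset d(F_s)$, then $\alpha_0=\alpha$, i.e., the mixture model is identifiable. If $d(F_b)\subset d(F_s)$, then $$\alpha_0=\alpha\left\{1-\inf_{x\in d(F_b)}\frac{J_{F_s}(x)}{J_{F_b}(x)}\right\}.$$ Thus, $\alpha_0=\alpha$ if and only if $\inf_{x\in d(F_b)}J_{F_s}(x)/J_{F_b}(x)=0$.
   Context: A discrete CDF is a piecewise constant CDF, i.e. the CDF of a probability measure that is a countable sum of point masses. For a CDF $G$, $d(G)=\{x\in\mathbb{R}: G(x)-G(x-)>0\}$ is the set of jump points of $G$, and $J_G:d(G)\to[0,1]$ is $J_G(x)=G(x)-G(x-)$. The mixture model $F=\alpha F_s+(1-\alpha)F_b$ (with $F_b$ known, $\alpha$ and $F_s$ unknown) is called identifiable if $\alpha_0=\alpha$.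
   Formalization: The final ''if and only if'' is proved for α > 0 only: at α = 0 one always has α₀ = 0 = α, while the infimum can be positive (e.g. F_s = (1/2,1/2), F_b = (1/3,2/3) on {0,1} gives 3/4). *)

(* Defs.v *)
From HB Require Import structures.
From mathcomp Require Import all_boot all_order all_algebra.
From mathcomp Require Import all_classical all_reals all_analysis.

Set Implicit Arguments.
Unset Strict Implicit.
Unset Printing Implicit Defensive.

Import Order.TTheory GRing.Theory Num.Theory.
Import numFieldNormedType.Exports.

Local Open Scope classical_set_scope.
Local Open Scope ring_scope.

Section Mixture.
Context {R : realType}.
Implicit Types (G F Fs Fb : R -> R) (alpha : R).

(* [cumulativeBounded 0 1] bundles the nondecreasing right-continuous
   functions with limits 0 at -oo and 1 at +oo. *)
Definition is_cdf G : Prop :=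
  exists H : cumulativeBounded (0 : R) (1 : R), G = H.

(* Weights may vanish and atoms may repeat, so a sequence indexed by [nat]
   also covers finite sums of point masses. *)
Definition is_discrete_probability
    (P : probability (measurableTypeR R) R) : Prop :=
  exists (a : nat -> measurableTypeR R) (w : nat -> {nonneg R}),
    forall A : set (measurableTypeR R), measurable A ->
      P A = mseries (fun n => mscale (w n) (dirac (a n))) 0 A.

Definition is_discrete_cdf G : Prop :=
  exists P : probability (measurableTypeR R) R,
    is_discrete_probability P /\ forall x : R, P `]-oo, x]%classic = (G x)%:E.

(* J_G, extended by the same formula from d(G) to the whole line; for a CDF
   the extension is 0 off d(G). *)
Definition jump G (x : R) : R := G x - lim (G y @[y --> x^'-]).

Definition jump_points G : set R := [set x | 0 < jump G x].

Definition mixture alpha Fs Fb : R -> R :=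
  fun x => alpha * Fs x + (1 - alpha) * Fb x.

(* The set always contains 1 when [F] is a CDF, so this real [inf] never takes
   its default value there. *)
Definition alpha0 F Fb : R :=
  inf [set gamma | 0 < gamma <= 1 /\
                   is_cdf (fun x => (F x - (1 - gamma) * Fb x) / gamma)].

Definition inf_jump_ratio Fs Fb : R :=
  inf [set jump Fs x / jump Fb x | x in jump_points Fb].

Definition identifiable alpha Fs Fb : Prop :=
  alpha0 (mixture alpha Fs Fb) Fb = alpha.

End Mixture.

(* Main.v *)
(** For [gamma] in (0, 1], [(F - (1 - gamma) Fb) / gamma] is the affine
    combination [a Fs + (1 - a) Fb] with [a = alpha / gamma], possibly [a > 1].
    Its limits and right continuity are automatic, and since [Fb] is purely
    atomic it is nondecreasing iff its jumps are nonnegative, i.e. iff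
    [(alpha - gamma) J_Fb <= alpha J_Fs] everywhere.  This amounts to
    [alpha (1 - m) <= gamma], where [m] is the infimum of [J_Fs / J_Fb] over
    [d(Fb)].  Hence [alpha0 = alpha (1 - m)] in all cases, and [m = 0] as soon
    as some atom of [Fb] is not an atom of [Fs]. *)

Require Import Defs.
From HB Require Import structures.
From mathcomp Require Import all_boot all_order all_algebra.
From mathcomp Require Import all_classical all_reals all_analysis.
From mathcomp Require Import ring.
Import Order.TTheory GRing.Theory Num.Theory.
Import numFieldNormedType.Exports.
Local Open Scope classical_set_scope.
Local Open Scope ring_scope.

(** * Distribution functions and their jumps *)

Lemma is_cdfP {R : realType} (G : R -> R) :
  is_cdf G <-> [/\ nondecreasing_fun G, right_continuous G,
    G @ -oo --> (0 : R) & G @ +oo --> (1 : R)].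
Proof.
split=> [[H ->]|[Gnd Grc G0 G1]].
  split.
  - exact: cumulative_is_nondecreasing.
  - exact: cumulative_is_right_continuous.
  - exact: cumulativeNy.
  - exact: cumulativey.
pose cumG := isCumulative.Build R _ R G Gnd Grc.
pose bndG := isCumulativeBounded.Build R 0 1 G G0 G1.
pose H : cumulativeBounded (0 : R) (1 : R) :=
  HB.pack G cumG bndG.
by exists H.
Qed.

Lemma nondecreasing_cvg_at_left {R : realType} (G : R -> R) (x : R) :
  nondecreasing_fun G -> cvg (G y @[y --> x^'-]).
Proof.
move=> Gnd; apply: nondecreasing_at_left_is_cvgr; apply: nearW => y.
  by move=> ? ? _ _; exact: Gnd.
exists (G x) => _ [z /= + <-]; rewrite in_itv/= => /andP[_ zx].
by apply: Gnd; exact: ltW.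
Qed.

Lemma jump_ge0 {R : realType} (G : R -> R) (x : R) :
  nondecreasing_fun G -> 0 <= jump G x.
Proof.
move=> Gnd; rewrite subr_ge0; apply: limr_le.
  exact: nondecreasing_cvg_at_left.
near=> y; apply: Gnd; near: y; exact: nbhs_left_le.
Unshelve. all: by end_near. Qed.

Lemma jump_mixture {R : realType} (a : R) (F G : R -> R) (x : R) :
  cvg (F y @[y --> x^'-]) -> cvg (G y @[y --> x^'-]) ->
  jump (mixture a F G) x = mixture a (jump F) (jump G) x.
Proof.
move=> cF cG; rewrite /jump /mixture.
have -> : lim (a * F y + (1 - a) * G y @[y --> x^'-]) =
    a * lim (F y @[y --> x^'-]) + (1 - a) * lim (G y @[y --> x^'-]).
  by apply/cvg_lim => //; apply: cvgD; apply: cvgMr.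
by rewrite !mulrBr opprD addrACA.
Qed.

Section DistributionFunction.
Context {R : realType} (P : probability (measurableTypeR R) R) (G : R -> R).
Hypothesis PG : forall x : R, P `]-oo, x]%classic = (G x)%:E.

(** Seen as a random variable under [P], the identity has [G] as its [cdf], so the limits and right
    continuity of [G] come from those of [cdf]. *)
Let idTR : measurableTypeR R -> R := idfun.

#[local] HB.instance Definition _ :=
  @isMeasurableFun.Build _ _ _ _ idTR (@measurable_id _ _ setT).

Lemma is_cdf_distribution : is_cdf G.
Proof.
have GE : G = fun r => fine (cdf (idTR : {RV P >-> R}) r).
  by apply/funext => x; rewrite -[LHS]/(fine (G x)%:E) -PG.
rewrite GE; apply/is_cdfP; split.
- by move=> *; rewrite fine_le ?fin_num_measure// cdf_nondecreasing.
- move=> a; apply: fine_cvg.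
  by rewrite fineK ?fin_num_measure//; exact: cdf_right_continuous.
- exact/fine_cvg/cvg_cdfNy0.
- exact/fine_cvg/cvg_cdfy1.
Qed.

Lemma jump_distribution (x : R) : P [set x] = (jump G x)%:E.
Proof.
have [Gnd _ _ _] : [/\ nondecreasing_fun G, right_continuous G,
    G @ -oo --> (0 : R) & G @ +oo --> (1 : R)].
  exact/is_cdfP/is_cdf_distribution.
have PGx : P `]-oo, x[%classic = (lim (G y @[y --> x^'-]))%:E.
  (* The points [u n] increase strictly to [x], so the rays []-oo, u n]] exhaust []-oo, x[].
     Continuity of [P] from below then identifies the mass of the open ray with the left limit of
     [G]. *)
  pose u n : R := x - n.+1%:R^-1.
  have uG : G (u n) @[n --> \oo] --> lim (G y @[y --> x^'-]).
    move/cvg_at_leftP: (nondecreasing_cvg_at_left _ x Gnd).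
    apply; split=> [n|]; first by rewrite /u gtrBl.
    rewrite -[X in _ --> X]subr0; apply: cvgB; first exact: cvg_cst.
    exact: cvg_harmonic.
  have uP : (G (u n))%:E @[n --> \oo] --> P `]-oo, x[%classic.
    have -> : (fun n => (G (u n))%:E) = P \o (fun n => `]-oo, u n]%classic).
      by apply/funext => n; exact/esym/PG.
    have -> : `]-oo, x[%classic = \bigcup_n `]-oo, u n]%classic.
      apply/seteqP; split => y /=.
        rewrite in_itv/= => yx; have xy0 : 0 < x - y by rewrite subr_gt0.
        have [k _ kxy] := near_infty_natSinv_lt (PosNum xy0).
        exists k => //=; rewrite in_itv/= /u lerBrDl -lerBrDr.
        by apply/ltW/kxy => /=.
      move=> [n _] /=; rewrite !in_itv/= => /le_lt_trans; apply.
      by rewrite /u gtrBl.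
    apply: nondecreasing_cvg_mu => [n||n m nm].
    - exact: measurable_itv.
    - by apply: bigcup_measurable => n _; exact: measurable_itv.
    - apply/subsetPset => y /=; rewrite !in_itv/= => /le_trans; apply.
      by rewrite lerB// lef_pV2 ?posrE// ler_nat.
  apply: (cvg_unique _ uP) => //.
  by apply: cvg_EFin uG; exact: nearW.
have : P `]-oo, x]%classic = (P `]-oo, x[%classic + P [set x])%E.
  rewrite -measureU//=.
  - by rewrite setUitv1.
  - apply/seteqP; split => // y [/=]; rewrite in_itv/= => + yx.
    by rewrite yx ltxx.
rewrite PG PGx.
have : P [set x] \is a fin_num by rewrite fin_num_measure.
case: (P [set x]) => // p _ [Gx].
by rewrite /jump Gx addrAC subrr add0r.
Qed.

Lemma cdf_increment (x y : R) : x <= y ->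
  P `]x, y]%classic = (G y - G x)%:E.
Proof.
move=> xy.
have : P `]-oo, y]%classic = (P `]-oo, x]%classic + P `]x, y]%classic)%E.
  rewrite -measureU//=.
  - by rewrite -itv_bndbnd_setU.
  - apply/seteqP; split => // z [/=]; rewrite !in_itv/= => zx /andP[xz _].
    by move: (le_lt_trans zx xz); rewrite ltxx.
rewrite !PG.
have : P `]x, y]%classic \is a fin_num by rewrite fin_num_measure.
by case: (P _) => // p _ [->]; rewrite addrAC subrr add0r.
Qed.

End DistributionFunction.

(** * Comparison of measures through their atoms *)

(** All the mass of [P] sits on the countable set [range a], where the bound follows by summing over
    points; mass of [Q] elsewhere only enlarges the right-hand side. *)
Lemma discrete_le_measure {R : realType}
    (P Q : probability (measurableTypeR R) R) (k l : R) :
  is_discrete_probability P -> 0 <= k -> 0 <= l ->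
  (forall x, k%:E * P [set x] <= l%:E * Q [set x])%E ->
  forall A, measurable A -> (k%:E * P A <= l%:E * Q A)%E.
Proof.
move=> [a [w Pa]] k0 l0 PQ A mA.
(* The sequence [a] may repeat atoms, so [seqDU] keeps only the first occurrence of each: every
   piece is empty or the singleton of [a n]. *)
pose B n : set (measurableTypeR R) := A `&` [set a n].
have m1 x : measurable ([set x] : set (measurableTypeR R)).
  exact: measurable_set1.
have mB n : measurable (B n) by exact: measurableI.
have mD n : measurable (seqDU B n) by exact: seqDU_measurable.
have mU : measurable (\bigcup_n seqDU B n) by exact: bigcup_measurable.
have UB : \bigcup_n seqDU B n = A `&` range a.
  rewrite -seqDU_bigcup_eq /B -setI_bigcupr; congr (_ `&` _).
  by apply/seteqP; split => [x [n _ ->]|_ [n _ <-]]; exists n.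
have PA : P A = P (\bigcup_n seqDU B n).
  (* Each Dirac mass at [a n] takes the same value on [A] and on [A] intersected with [range a]. *)
  rewrite !Pa// /mseries; apply: eq_eseriesr => n _; rewrite /mscale /= UB.
  congr (_ * _%:R%:E)%E; congr (nat_of_bool _).
  apply/idP/idP; rewrite !inE; last by case.
  by split=> //; exists n.
rewrite PA (@le_trans _ _ (l%:E * Q (\bigcup_n seqDU B n))%E)//; last first.
  apply: lee_wpmul2l; first by rewrite lee_fin.
  by apply: le_measure; rewrite ?inE// UB; exact: subIsetl.
rewrite !measure_bigcup//; try exact: trivIset_seqDU.
rewrite -!nneseriesZl//; apply: lee_nneseries => [n _ _|n _].
  by rewrite mule_ge0.
have /subset_set1 [->|->] : seqDU B n `<=` [set a n].
  exact: (subset_trans (@subset_seqDU _ B n) (@subIsetr _ _ _)).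
- by rewrite !measure0 !mule0.
- exact: PQ.
Qed.

Lemma discrete_cdf_is_cdf {R : realType} (F : R -> R) : is_discrete_cdf F -> is_cdf F.
Proof. by move=> [P [_ /is_cdf_distribution]]. Qed.

Lemma discrete_jump_ge0 {R : realType} (F : R -> R) (x : R) :
  is_discrete_cdf F -> 0 <= jump F x.
Proof. by move=> /discrete_cdf_is_cdf/is_cdfP[? _ _ _]; exact: jump_ge0. Qed.

Lemma is_cdf_mixture {R : realType} (Fs Fb : R -> R) (a : R) :
  is_discrete_cdf Fs -> is_discrete_cdf Fb -> 0 <= a ->
  is_cdf (mixture a Fs Fb) <->
  forall x, 0 <= mixture a (jump Fs) (jump Fb) x.
Proof.
move=> hFs hFb a0.
have /is_cdfP[Fsnd Fsrc Fs0 Fs1] := discrete_cdf_is_cdf _ hFs.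
have /is_cdfP[Fbnd Fbrc Fb0 Fb1] := discrete_cdf_is_cdf _ hFb.
split=> [/is_cdfP[nd _ _ _] x|jge0].
  rewrite -jump_mixture; first exact: jump_ge0.
  - exact: nondecreasing_cvg_at_left.
  - exact: nondecreasing_cvg_at_left.
apply/is_cdfP; split.
- move=> x y xy; have [a1|a1] := leP a 1.
    by rewrite lerD// ler_wpM2l ?subr_ge0// ?Fsnd ?Fbnd.
  (* For [a > 1] the increment over []x, y]] is [a P - (a - 1) Q] of that interval. Nonnegative
     jumps give the comparison on singletons with weights [a - 1] and [a], which then extends to
     intervals. *)
  have [P [_ PFs]] := hFs; have [Q [dQ QFb]] := hFb.
  have := @discrete_le_measure _ Q P (a - 1) a dQ _ a0 _ `]x, y]%classic.
  rewrite (cdf_increment _ _ PFs _ _ xy) (cdf_increment _ _ QFb _ _ xy).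
  rewrite -!EFinM lee_fin subr_ge0 => /(_ (ltW a1)) h.
  rewrite -subr_ge0 /mixture opprD addrACA -!mulrBr -[1 - a]opprB mulNr subr_ge0.
  apply: h; last exact: measurable_itv.
  move=> z; rewrite (jump_distribution _ _ PFs) (jump_distribution _ _ QFb).
  rewrite -!EFinM lee_fin -subr_ge0; move: (jge0 z).
  by rewrite /mixture -[1 - a]opprB mulNr.
- by move=> x; apply: cvgD; apply: cvgMr; [exact: Fsrc|exact: Fbrc].
- rewrite (_ : 0 = a * 0 + (1 - a) * 0); last by rewrite !mulr0 addr0.
  by apply: cvgD; apply: cvgMr.
- rewrite [X in _ --> X](_ : 1 = a * 1 + (1 - a) * 1); last first.
    by rewrite !mulr1 addrC subrK.
  by apply: cvgD; apply: cvgMr.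
Qed.

(** Compare the total masses, both equal to 1. *)
Lemma discrete_jump_le {R : realType} (Fs Fb : R -> R) (k : R) :
  is_discrete_cdf Fs -> is_discrete_cdf Fb -> 0 <= k ->
  (forall x, k * jump Fb x <= jump Fs x) -> k <= 1.
Proof.
move=> [P [_ PFs]] [Q [dQ QFb]] k0 kle.
have := @discrete_le_measure _ Q P k 1 dQ k0 ler01 _ setT measurableT.
rewrite !probability_setT !mule1 lee_fin; apply=> x.
by rewrite (jump_distribution _ _ PFs) (jump_distribution _ _ QFb) mul1e lee_fin.
Qed.

Lemma jump_points_neq0 {R : realType} (F : R -> R) :
  is_discrete_cdf F -> jump_points F !=set0.
Proof.
move=> dF; apply/set0P/eqP => F0.
(* If all jumps vanished, [F] would satisfy the jump comparison with itself for any factor, in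
   particular 2. *)
suff : (2 : R) <= 1 by rewrite leNgt ltr1n.
apply: (@discrete_jump_le _ F F) => // x.
have : ~ jump_points F x by rewrite F0.
have := discrete_jump_ge0 _ x dF; rewrite /jump_points/= le_eqVlt.
by case/orP => [/eqP <- _|//]; rewrite mulr0.
Qed.

(** * The infimum of the jump ratio and the value of [alpha0] *)

Lemma inf_truncated_ray {R : realType} (c : R) : 0 <= c <= 1 ->
  inf [set g : R | 0 < g <= 1 /\ c <= g] = c.
Proof.
move=> /andP[c0 c1]; set E := [set g | _].
have E1 : E 1 by rewrite /E/= ltr01 lexx.
have lbE : lbound E c by move=> g [].
apply/eqP; rewrite eq_le; apply/andP; split; last first.
  by apply: lb_le_inf => //; exists 1.
have infE g : E g -> inf E <= g by apply: ge_inf; exists c.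
rewrite leNgt; apply/negP => cinf.
(* For [c = 0] the bound is not attained, so [c] itself cannot serve as witness; the midpoint is
   positive in every case. *)
have [cm mi] := midf_lt cinf.
have /infE : E ((c + inf E) / 2).
  split; last exact: ltW.
  by rewrite (le_lt_trans c0 cm)/= (le_trans (ltW mi))// infE.
by rewrite leNgt mi.
Qed.

Section InfJumpRatio.
Context {R : realType} (Fs Fb : R -> R).
Hypotheses (dFs : is_discrete_cdf Fs) (dFb : is_discrete_cdf Fb).

Let Js_ge0 x : 0 <= jump Fs x. Proof. exact: discrete_jump_ge0. Qed.

Let lbound0_ratio :
  lbound [set jump Fs x / jump Fb x | x in jump_points Fb] 0.
Proof. by move=> _ [x Jb0 <-]; rewrite divr_ge0// ltW. Qed.

Lemma inf_jump_ratio_ge0 : 0 <= inf_jump_ratio Fs Fb.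
Proof.
apply: lb_le_inf lbound0_ratio.
by have [x Jb0] := jump_points_neq0 _ dFb; exists (jump Fs x / jump Fb x), x.
Qed.

(** Clearing denominators lets the bound range over all points: where [Fb] does not jump it only
    says that jumps of [Fs] are nonnegative. The factor [k] may be negative. *)
Lemma le_inf_jump_ratio (k : R) :
  k <= inf_jump_ratio Fs Fb <-> forall x, k * jump Fb x <= jump Fs x.
Proof.
split=> [km x|kle]; last first.
  apply: lb_le_inf.
    by have [x Jb0] := jump_points_neq0 _ dFb; exists (jump Fs x / jump Fb x), x.
  by move=> _ [x Jb0 <-]; rewrite ler_pdivlMr.
have := discrete_jump_ge0 _ x dFb; rewrite le_eqVlt => /orP[/eqP <-|Jb0].
  by rewrite mulr0 Js_ge0.
rewrite -ler_pdivlMr//; apply: (le_trans km); apply: ge_inf; last by exists x.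
by exists 0.
Qed.

Lemma inf_jump_ratio_le1 : inf_jump_ratio Fs Fb <= 1.
Proof.
apply: (@discrete_jump_le _ Fs Fb) => //; first exact: inf_jump_ratio_ge0.
exact/le_inf_jump_ratio.
Qed.

Lemma inf_jump_ratio_eq0 :
  ~ (jump_points Fb `<=` jump_points Fs) -> inf_jump_ratio Fs Fb = 0.
Proof.
move=> /existsNP[x] /not_implyP[Jb0 /negP]; rewrite -leNgt => Js0.
apply/eqP; rewrite eq_le inf_jump_ratio_ge0 andbT.
have := (le_inf_jump_ratio _).1 (lexx _) x => /le_trans /(_ Js0).
by rewrite pmulr_lle0.
Qed.

Lemma alpha0_mixture (alpha : R) : 0 <= alpha <= 1 ->
  alpha0 (mixture alpha Fs Fb) Fb = alpha * (1 - inf_jump_ratio Fs Fb).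
Proof.
move=> /andP[al0 al1]; set m := inf_jump_ratio Fs Fb.
have m0 : 0 <= m := inf_jump_ratio_ge0.
have m1 : 0 <= 1 - m by rewrite subr_ge0 inf_jump_ratio_le1.
(* Writing the target as an infimum too reduces the claim to an equality of sets. *)
rewrite /alpha0 -[RHS]inf_truncated_ray; last first.
  by rewrite mulr_ge0//= mulr_ile1// gerBl.
congr inf; apply/seteqP.
suff cdfE g : 0 < g ->
    is_cdf (fun x => (mixture alpha Fs Fb x - (1 - g) * Fb x) / g) <->
    alpha * (1 - m) <= g.
  by split=> g [/andP[g0 g1] /cdfE gm]; split; rewrite ?g0//; apply: gm.
move=> g0; rewrite (_ : (fun x => _) = mixture (alpha / g) Fs Fb); last first.
  by apply/funext => x; rewrite /mixture; field; rewrite gt_eqF.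
apply: (iff_trans (is_cdf_mixture _ _ _ dFs dFb _)); first exact: divr_ge0 (ltW g0).
have jumpE x : (0 <= mixture (alpha / g) (jump Fs) (jump Fb) x) =
    ((alpha - g) * jump Fb x <= alpha * jump Fs x).
  rewrite -[RHS]subr_ge0 -(pmulr_lge0 _ (_ : 0 < g^-1)) ?invr_gt0//.
  by congr (0 <= _); rewrite /mixture; field; rewrite gt_eqF.
(* The case [alpha = 0] is separate because the threshold on [g] is later solved for [m] by dividing
   by [alpha]; here both sides of the equivalence hold. *)
have [al_eq0|al_gt0] := eqVneq alpha 0.
  split=> [_|_ x]; first by rewrite al_eq0 mul0r ltW.
  rewrite jumpE al_eq0 sub0r mul0r mulNr oppr_le0.
  by apply: mulr_ge0; [exact: ltW|exact: discrete_jump_ge0].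
have {}al_gt0 : 0 < alpha by rewrite lt_def al_gt0.
have -> : (alpha * (1 - m) <= g) = ((alpha - g) / alpha <= m).
  by rewrite ler_pdivrMr// mulrBr mulr1 lerBlDr -lerBlDl mulrC.
apply: iff_sym; apply: (iff_trans (le_inf_jump_ratio _)).
have ratioE x : ((alpha - g) / alpha * jump Fb x <= jump Fs x) =
    (0 <= mixture (alpha / g) (jump Fs) (jump Fb) x).
  by rewrite jumpE mulrAC ler_pdivrMr// [jump Fs x * _]mulrC.
by split=> h x; move: (h x); rewrite ratioE.
Qed.

End InfJumpRatio.

(** The last equivalence assumes [0 < alpha], since at [alpha = 0] the model is identifiable
    whatever the infimum is. *)
Theorem lemma3 (R : realType) (alpha : R) (Fs Fb : R -> R)
    (halpha : 0 <= alpha <= 1)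
    (hFs : is_discrete_cdf Fs) (hFb : is_discrete_cdf Fb)
    (hneq : Fs <> Fb) :
  [/\ ~ (jump_points Fb `<=` jump_points Fs) -> identifiable alpha Fs Fb,
      jump_points Fb `<=` jump_points Fs ->
        alpha0 (mixture alpha Fs Fb) Fb = alpha * (1 - inf_jump_ratio Fs Fb)
    & 0 < alpha -> (identifiable alpha Fs Fb <-> inf_jump_ratio Fs Fb = 0)].
Proof.
rewrite /identifiable alpha0_mixture//; split=> // [nsub|al0].
  by rewrite inf_jump_ratio_eq0// subr0 mulr1.
split=> [|->]; last by rewrite subr0 mulr1.
rewrite -[RHS]mulr1 => /(mulfI (lt0r_neq0 al0)) /eqP.
by rewrite subr_eq addrC -subr_eq subrr eq_sym => /eqP.
Qed.
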